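(* For each $n$ let $V_1,\ldots,V_m$ be a partition of $[n]$ into communities, let $\mathbf{q}=\{q_{ab}\}_{a,b\in[m]}$ be a symmetric collection of elements of $[0,1]$, and let $s\in[0,1]$ (all, including $m$, possibly depending on $n$). Let $(G_1,G_2)$ be a pair of correlated stochastic block models with parameters $(V_1,\ldots,V_m,\mathbf{q},s)$ and latent permutation $\pi_*$. Suppose that $\max_{a,b\in[m]}q_{ab}\le n^{-\alpha+o(1)}$ for some constant $\alpha\in(1/2,1]$ and that $k>12/(2\alpha-1)$ is a constant positive integer. Furthermore, suppose that there exists a constant $\epsilon>0$ such that $$\min_{a\in[m]}\sum_{b=1}^m|V_b|\,q_{ab}\,s^2\ge(1+\epsilon)\log n .$$ Let $(\widehat M_k,\widehat\mu_k)$ be the $k$-core estimator of $(G_1,G_2)$. Then $\mathbb{P}(\widehat\mu_k=\pi_* )=1-o(1)$ as $n\to\infty$ (where $\widehat\mu_k=\pi_*$ means $\widehat M_k=[n]$ and $\widehat\mu_k(i)=\pi_*(i)$ for all $i$).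
   Context: Correlated stochastic block models with parameters $(V_1,\ldots,V_m,\mathbf{q},s)$: generate a simple undirected random graph $G$ on $[n]$ in which each edge $\{i,j\}$, $i\ne j$, is present with probability $p_{ij}=q_{ab}$ whenever $i\in V_a$, $j\in V_b$, independently over unordered pairs; conditionally on $G$, generate $G_1$ and $G_2'$ independently, each keeping every edge of $G$ independently with probability $s$ (same vertex set $[n]$); finally let $\pi_*$ be an independent uniformly random permutation of $[n]$ and let $G_2$ be $G_2'$ with vertices relabelled by $\pi_*$, so that $\{\pi_*(i),\pi_*(j)\}$ is an edge of $G_2$ iff $\{i,j\}$ is an edge of $G_2'$. A matching is a pair $(M,\mu)$ with $M\subseteq[n]$ and $\mu:M\to[n]$ injective. $G_1\wedge_\mu G_2$ is the graph on vertex set $M$ in which $\{i,j\}$ is an edge iff $\{i,j\}$ is an edge of $G_1$ and $\{\mu(i),\mu(j)\}$ is an edge of $G_2$. A matching is a $k$-core matching if every vertex of $G_1\wedge_\mu G_2$ has degree at least $k$ (the empty matching qualifies vacuously). The $k$-core estimator $(\widehat M_k,\widehat\mu_k)$ is a $k$-core matching of $(G_1,G_2)$ with $|M|$ as large as possible among all $k$-core matchings (ties broken arbitrarily). A bound $x_n\le n^{-\alpha+o(1)}$ means $x_n\le n^{-\alpha+\varepsilon_n}$ for some deterministic sequence $\varepsilon_n\to0$. *)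

(* Defs.v *)
From HB Require Import structures.
From mathcomp Require Import all_boot all_order all_algebra all_fingroup.
From mathcomp Require Import all_classical all_reals all_analysis.

Set Implicit Arguments.
Unset Strict Implicit.
Unset Printing Implicit Defensive.

Import Order.TTheory GRing.Theory Num.Theory.

Local Open Scope ring_scope.

Definition is_simple n (e : {ffun 'I_n * 'I_n -> bool}) : bool :=
  [forall i, ~~ e (i, i)] && [forall i, forall j, e (i, j) == e (j, i)].

Record sgraph (n : nat) := SGraph {
  edge_fun : {ffun 'I_n * 'I_n -> bool};
  edge_funP : is_simple edge_fun }.

HB.instance Definition _ n := [isSub for @edge_fun n].
HB.instance Definition _ n := [Countable of sgraph n by <:].
HB.instance Definition _ n := [Finite of sgraph n by <:].

Definition adj n (G : sgraph n) (i j : 'I_n) : bool := edge_fun G (i, j).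

Lemma relabel_subproof n (pi : {perm 'I_n}) (G : sgraph n) :
  is_simple [ffun e : 'I_n * 'I_n => adj G (pi^-1%g e.1) (pi^-1%g e.2)].
Proof.
have /andP[/forallP e0 /forallP eC] := edge_funP G; apply/andP; split.
  by apply/forallP => i; rewrite ffunE /adj; apply: e0.
apply/forallP => i; apply/forallP => j; rewrite !ffunE.
by apply: (forallP (eC _)).
Qed.

Definition relabel n (pi : {perm 'I_n}) (G : sgraph n) : sgraph n :=
  SGraph (relabel_subproof pi G).

Lemma adj_relabel n (pi : {perm 'I_n}) (G : sgraph n) i j :
  adj (relabel pi G) (pi i) (pi j) = adj G i j.
Proof. by rewrite /adj ffunE /= !permK. Qed.

(* The law on simple graphs under which the unordered pairs {i, j}, each
   represented by its ordering i < j, are independently edges with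
   probability p i j. *)
Definition indep_edges_pmf (R : realType) n (p : 'I_n -> 'I_n -> R)
    (G : sgraph n) : R :=
  \prod_(e : 'I_n * 'I_n | (e.1 < e.2)%N)
    bernoulli_pmf (p e.1 e.2) (adj G e.1 e.2).

(* Blocks are allowed to be empty. *)
Record csbm_params (R : realType) (n : nat) := CsbmParams {
  ncomm : nat;
  comm : 'I_ncomm -> {set 'I_n};
  comm_disjoint : forall a b, a != b -> [disjoint comm a & comm b];
  comm_cover : \bigcup_a comm a = [set: 'I_n];
  qprob : 'I_ncomm -> 'I_ncomm -> R;
  qprob_sym : forall a b, qprob a b = qprob b a;
  qprob01 : forall a b, 0 <= qprob a b <= 1;
  sprob : R;
  sprob01 : 0 <= sprob <= 1 }.

Arguments comm {R n} c a.
Arguments qprob {R n} c a b.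

(* As the blocks partition the vertices, this sum has exactly one term,
   namely q_ab for the blocks V_a containing i and V_b containing j. *)
Definition edge_prob (R : realType) n (th : csbm_params R n) (i j : 'I_n) : R :=
  \sum_(a | i \in comm th a) \sum_(b | j \in comm th b) qprob th a b.

Definition thin_prob (R : realType) n (s : R) (G : sgraph n) (i j : 'I_n) : R :=
  if adj G i j then s else 0.

(* The joint mass of the outcome (G, G_1, G_2', pi), by the chain rule:
   given the parent G, the graphs G_1 and G_2' are independent s-thinnings. *)
Definition csbm_pmf (R : realType) n (th : csbm_params R n)
    (G G1 G2' : sgraph n) (pi : {perm 'I_n}) : R :=
  indep_edges_pmf (edge_prob th) G
  * indep_edges_pmf (thin_prob (sprob th) G) G1
  * indep_edges_pmf (thin_prob (sprob th) G) G2'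
  * (n`!%:R)^-1.

(* The probability of an event A about (G_1, G_2, pi). *)
Definition csbm_prob (R : realType) n (th : csbm_params R n)
    (A : sgraph n -> sgraph n -> {perm 'I_n} -> bool) : R :=
  \sum_(G : sgraph n) \sum_(G1 : sgraph n) \sum_(G2' : sgraph n)
    \sum_(pi : {perm 'I_n} | A G1 (relabel pi G2') pi)
      csbm_pmf th G G1 G2' pi.

(* A matching (M, mu) is encoded with mu total; only the values of mu on M
   are constrained by, or enter into, the definitions below. *)
Definition is_matching n (M : {set 'I_n}) (mu : 'I_n -> 'I_n) : Prop :=
  {in M &, injective mu}.

Definition inter_degree n (G1 G2 : sgraph n) (M : {set 'I_n})
    (mu : 'I_n -> 'I_n) (i : 'I_n) : nat :=
  #|[set j in M | adj G1 i j && adj G2 (mu i) (mu j)]|.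

Definition is_kcore_matching n (k : nat) (G1 G2 : sgraph n)
    (M : {set 'I_n}) (mu : 'I_n -> 'I_n) : Prop :=
  is_matching M mu /\
  (forall i, i \in M -> (k <= inter_degree G1 G2 M mu i)%N).

Definition is_max_kcore_matching n (k : nat) (G1 G2 : sgraph n)
    (M : {set 'I_n}) (mu : 'I_n -> 'I_n) : Prop :=
  is_kcore_matching k G1 G2 M mu /\
  (forall (M' : {set 'I_n}) (mu' : 'I_n -> 'I_n),
     is_kcore_matching k G1 G2 M' mu' -> (#|M'| <= #|M|)%N).

(* A k-core estimator is a function of the observed pair (G_1, G_2); its
   choice among the maximum k-core matchings is unconstrained. *)
Definition is_kcore_estimator n (k : nat)
    (est : sgraph n -> sgraph n -> {set 'I_n} * ('I_n -> 'I_n)) : Prop :=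
  forall G1 G2 : sgraph n,
    is_max_kcore_matching k G1 G2 (est G1 G2).1 (est G1 G2).2.

Definition recovers n (pi : {perm 'I_n}) (Mmu : {set 'I_n} * ('I_n -> 'I_n)) :
    bool :=
  (Mmu.1 == [set: 'I_n]) && [forall i, Mmu.2 i == pi i].

(* Main.v *)
Require Import Defs.
From mathcomp Require Import all_boot all_order all_algebra all_fingroup.
From mathcomp Require Import all_classical all_reals all_analysis.
From mathcomp Require Import zify ring lra.
Import Order.TTheory GRing.Theory Num.Theory.
Import numFieldNormedType.Exports.
Set Implicit Arguments.
Unset Strict Implicit.
Unset Printing Implicit Defensive.
Local Open Scope ring_scope.

(** Why the k-core estimator is exact.

    Undo the latent relabelling: after composing with the inverse of pi, a
    permutation of the vertices becomes a permutation s, the truth becomes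
    the identity, and the intersection graph along s joins i and j when {i, j}
    is an edge of G_1 and {s i, s j} is an edge of G_2'.  Recovery follows from
    two properties of (G_1, G_2') ([recovers_of_good]): every vertex has degree
    at least k in the intersection along the identity, so that the truth is a
    k-core matching of full size and the maximum is a permutation; and no
    nonidentity s has all its degrees at least k.  Both properties hold with
    probability tending to one.

    Degrees along the identity.  The degree of i is a sum of independent
    indicators of mean at least (1 + eps) log n - 1, so Markov's inequality for
    z ^ degree bounds the probability that it is below k by a constant times
    exp (- (1 - z) (1 + eps) log n) ([expect_low_degree]).  For
    z = eps / (2 (1 + eps)) this is a constant times n ^ (- 1 - eps / 2), which
    beats the union over the n vertices.

    Wrong permutations.  Let s move d > 0 vertices and have all its degrees at
    least k.  A moved vertex i loses at most one neighbour, namely s i, if edges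
    mapped to themselves by s are dropped; hence at least (k - 1) d / 2 edges e
    of G_1 touch a moved vertex and have s e <> e an edge of G_2'.  The events
    for e and s e are dependent, because they share parent edges, but a greedy
    choice ([sparse_subset]) keeps a third of those edges so that the kept set
    T is disjoint from s T ([kcore_perm_witness]).  Then T and s T consist of
    2 t distinct parent edges, where t >= (k - 1) d / 6, and this has
    probability at most q ^ (2 t) ([expect_present]).  There are at most
    binomial (2 n d) t <= (8 n) ^ t candidates T ([card_witness]), so s survives
    with probability at most (8 n q ^ 2) ^ t, where 8 n q ^ 2 is
    n ^ (1 - 2 alpha + o(1)) ([expect_kcore_perm]).  At most n ^ d permutations
    move exactly d vertices ([sum_moved]), and n (8 n q ^ 2) ^ ((k - 1) / 6) is
    at most n ^ (1 - 11 / 6 + o(1)) because (k - 1) (2 alpha - 1) > 11.  As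
    d >= 2, summing over d leaves a quantity that tends to zero
    ([wrong_perm_rate]). *)

(** * Edges permuted by a relabelling, and sparse witnesses *)

(** The model is a product over the pairs (i, j) with i < j, so an unordered
    pair of distinct vertices is represented by its increasing ordering. *)
Definition ordpair n (i j : 'I_n) : 'I_n * 'I_n :=
  if (i < j)%N then (i, j) else (j, i).

Definition act_pair n (s : {perm 'I_n}) (e : 'I_n * 'I_n) : 'I_n * 'I_n :=
  ordpair (s e.1) (s e.2).

Definition moved n (s : {perm 'I_n}) : {set 'I_n} := [set i | s i != i].

(** Both orderings are included: the factor two in the cardinal only costs a
    constant base in the final bound. *)
Definition touching n (s : {perm 'I_n}) : {set 'I_n * 'I_n} :=
  finset.setX (moved s) [set: _] :|:
  finset.setX [set: _] (moved s).

Definition common_nbrs n (G1 G2 : sgraph n) (s : {perm 'I_n}) (i : 'I_n) :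
    {set 'I_n} :=
  [set j | adj G1 i j && adj G2 (s i) (s j)].

(** Here G2 is G_2', before the relabelling by pi: the condition says that
    pi \o s, on all vertices, is a k-core matching of G_1 and G_2. *)
Definition kcore_perm n k (G1 G2 : sgraph n) (s : {perm 'I_n}) : bool :=
  [forall i, (k <= #|common_nbrs G1 G2 s i|)%N].

(** Disjointness from the image under s is what makes the 2 t edges in T and
    its image distinct, hence independent. *)
Definition witness n (s : {perm 'I_n}) (t : nat) (T : {set 'I_n * 'I_n}) :
    bool :=
  [&& T \subset touching s, [forall e in T, (e.1 < e.2)%N],
      [disjoint T & act_pair s @: T] & #|T| == t].

Definition present n (G1 G2 : sgraph n) (s : {perm 'I_n})
    (T : {set 'I_n * 'I_n}) : bool :=
  [forall e in T, adj G1 e.1 e.2] &&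
  [forall e in (act_pair s @: T), adj G2 e.1 e.2].

Lemma adjC n (G : sgraph n) i j : adj G i j = adj G j i.
Proof.
have /andP[_ /forallP /(_ i) /forallP /(_ j) /eqP] := edge_funP G.
by rewrite /adj.
Qed.

Lemma adj_irr n (G : sgraph n) i : adj G i i = false.
Proof.
have /andP[/forallP /(_ i) /negbTE + _] := edge_funP G.
by rewrite /adj.
Qed.

Lemma adj_ordpair n (G : sgraph n) i j :
  adj G (ordpair i j).1 (ordpair i j).2 = adj G i j.
Proof. by rewrite /ordpair; case: ifP => //= _; rewrite adjC. Qed.

Lemma ordpair_lt n (i j : 'I_n) :
  i != j -> ((ordpair i j).1 < (ordpair i j).2)%N.
Proof.
move=> ij; rewrite /ordpair; case: ifP => //= /negbT.
rewrite -leqNgt leq_eqVlt => /orP[/eqP/val_inj ji|//].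
by rewrite ji eqxx in ij.
Qed.

Lemma ordpair_eq n (i j k l : 'I_n) : ordpair i j = ordpair k l ->
  (i = k /\ j = l) \/ (i = l /\ j = k).
Proof.
rewrite /ordpair; case: ifP => _; case: ifP => _ [-> ->];
  by [left|right|right|left].
Qed.

Lemma ordpairC n (i j : 'I_n) : ordpair i j = ordpair j i.
Proof.
by rewrite /ordpair; case: ltngtP => // /val_inj ->.
Qed.

Lemma act_ordpair n (s : {perm 'I_n}) i j :
  act_pair s (ordpair i j) = ordpair (s i) (s j).
Proof.
by rewrite /act_pair {2 3}/ordpair; case: ifP => //= _; rewrite ordpairC.
Qed.

Lemma act_pair_inj n (s : {perm 'I_n}) :
  {in [pred e : 'I_n * 'I_n | (e.1 < e.2)%N] &, injective (act_pair s)}.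
Proof.
move=> [i j] [k l]; rewrite !inE /= => ij kl /ordpair_eq /=.
case=> -[/perm_inj eik /perm_inj ejl]; subst => //.
by have := ltn_trans ij kl; rewrite ltnn.
Qed.

(** Take A maximal among the subsets of S that are disjoint from their image.
    Every x in S then lies in A, in f A, or in the preimage of A, since
    otherwise x could be added to A; each of these has at most #|A| elements.
    On the cycles of f this is the fact that a cycle of length at least two
    has an independent set of a third of its vertices. *)
Lemma sparse_subset (T : finType) (f : T -> T) (S : {set T}) :
  {in S &, injective f} -> (forall x, x \in S -> f x != x) ->
  exists A : {set T}, [/\ A \subset S, [disjoint A & f @: A]
    & (#|S| <= 3 * #|A|)%N].
Proof.
move=> finj fne.
pose P (A : {set T}) := (A \subset S) && [disjoint A & f @: A].
have P0 : P finset.set0.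
  by rewrite /P finset.sub0set -finset.setI_eq0 finset.set0I eqxx.
have [A /maxsetP[/andP[AS dA] Amax] _] := maxset_exists P0.
exists A; split=> //.
pose B := [set x in S | f x \in A].
have SU : S \subset (A :|: f @: A :|: B).
  apply/fintype.subsetP => x xS; rewrite !inE xS /=.
  apply/negPn/negP; rewrite !negb_or => /andP[/andP[xA xfA] fxA].
  have : P (x |: A).
    rewrite /P finset.subUset finset.sub1set xS AS /=.
    rewrite -finset.setI_eq0; apply/eqP/finset.setP => y; rewrite !inE.
    apply/negbTE/negP => /andP[/orP[/eqP ->|yA] /imsetP[z]].
      rewrite !inE => /orP[/eqP -> xfx|zA xfz].
        by have := fne _ xS; rewrite -xfx eqxx.
      by move/negP: xfA; apply; apply/imsetP; exists z.
    rewrite !inE => /orP[/eqP -> yfx|zA yfz].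
      by rewrite -yfx yA in fxA.
    have : y \in A :&: f @: A.
      by rewrite inE yA /=; apply/imsetP; exists z.
    by rewrite (eqP (introT eqP (disjoint_setI0 dA))) inE.
  move=> PU; have := Amax _ PU (finset.subsetUr _ _) => AU.
  by move: xA; rewrite -AU !inE eqxx.
have cB : (#|B| <= #|A|)%N.
  rewrite -(@card_in_imset _ _ f B).
    apply: subset_leq_card; apply/fintype.subsetP => y /imsetP[x].
    by rewrite inE => /andP[_ h] ->.
  by move=> x y; rewrite !inE => /andP[xS _] /andP[yS _]; apply: finj.
apply: leq_trans (subset_leq_card SU) _.
have := (leq_card_setU (finset.setU A (f @: A)) B).1.
have := (leq_card_setU A (f @: A)).1; have := leq_imset_card f A.
lia.
Qed.

Lemma subset_of_card (T : finType) (A : {set T}) t : (t <= #|A|)%N ->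
  exists2 B : {set T}, B \subset A & #|B| = t.
Proof.
move=> /card_geqP[r [ur sr rA]]; exists [set x in r].
  by apply/fintype.subsetP => x; rewrite inE => /rA.
by rewrite cardsE -sr; apply/card_uniqP.
Qed.

(** For a moved vertex i and a common neighbour j other than s i, the edge
    {i, j} is not mapped to itself by s.  This gives at least (k - 1) d ordered
    pairs, hence half as many edges, of which [sparse_subset] keeps a third. *)
Lemma kcore_perm_witness n k (G1 G2 : sgraph n) (s : {perm 'I_n}) t :
  kcore_perm k G1 G2 s ->
  (forall m, k.-1 * #|moved s| <= 6 * m -> t <= m)%N ->
  exists T, witness s t T && present G1 G2 s T.
Proof.
move=> /forallP kc tmin.
pose S : {set 'I_n * 'I_n} := [set e | [&& e \in touching s, (e.1 < e.2)%N,
  act_pair s e != e, adj G1 e.1 e.2 & adj G2 (s e.1) (s e.2)]].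
have [A [AS dA cA]] : exists A : {set 'I_n * 'I_n}, [/\ A \subset S,
    [disjoint A & act_pair s @: A] & (#|S| <= 3 * #|A|)%N].
  apply: sparse_subset => [x y|x]; rewrite !inE.
    by move=> /and5P[_ xl _ _ _] /and5P[_ yl _ _ _]; apply: act_pair_inj.
  by case/and5P.
pose P : {set 'I_n * 'I_n} := [set e | [&& e.1 \in moved s, e.2 != s e.1 &
   e.2 \in common_nbrs G1 G2 s e.1]].
have cP : (k.-1 * #|moved s| <= #|P|)%N.
  rewrite mulnC -sum_nat_const.
  have -> : #|P| = (\sum_(i in moved s)
      \sum_(j | (j != s i) && (j \in common_nbrs G1 G2 s i)) 1)%N.
    rewrite pair_big_dep /= sum1dep_card; apply: eq_card => -[i j].
    by rewrite !inE.
  apply: leq_sum => i _; rewrite sum1dep_card.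
  have := kc i; rewrite (cardsD1 (s i) (common_nbrs G1 G2 s i)).
  rewrite (_ : #|[set x | _]| = #|(common_nbrs G1 G2 s i :\ s i)|).
    by case: (_ \in _) => /=; lia.
  by apply: eq_card => j; rewrite !inE.
(* An edge arises from at most two ordered pairs, itself and its swap. *)
pose sw (e : 'I_n * 'I_n) := (e.2, e.1).
have PS : P \subset (S :|: sw @: S).
  apply/fintype.subsetP => -[i j]; rewrite inE /= => /and3P[+ js +].
  rewrite [_ \in moved s]inE inE => si /andP[a1 a2].
  have ij : i != j by apply: contraTneq a1 => ->; rewrite adj_irr.
  have h (e : 'I_n * 'I_n) : e = ordpair i j -> e \in S.
    move=> ee; rewrite /S inE; apply/and5P; split.
    - rewrite ee /touching !inE /ordpair; case: ifP => _ /=;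
        by rewrite si ?orbT.
    - by rewrite ee ordpair_lt.
    - have : act_pair s (i, j) != ordpair i j.
        apply/eqP => /ordpair_eq /=; case=> -[h1 h2].
          by rewrite h1 eqxx in si.
        by rewrite h1 eqxx in js.
      by rewrite ee act_ordpair.
    - by rewrite ee adj_ordpair.
    rewrite ee /ordpair; case: ifP => //= _; by rewrite adjC.
  case: (ltnP i j) => lij.
    by rewrite finset.in_setU h // /ordpair lij.
  rewrite finset.in_setU; apply/orP; right; apply/imsetP; exists (j, i) => //.
  by apply: h; rewrite /ordpair ltnNge lij.
have tA : (t <= #|A|)%N.
  apply: tmin; apply: leq_trans cP _; apply: leq_trans (subset_leq_card PS) _.
  apply: leq_trans (leq_card_setU S (sw @: S)).1 _.
  apply: leq_trans (leq_add cA (leq_trans (leq_imset_card _ _) cA)) _.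
  by rewrite -mulnDl.
have [B BA cB] := subset_of_card tA.
have hB e : e \in B -> e \in S.
  by move=> /(fintype.subsetP BA)/(fintype.subsetP AS).
exists B; apply/andP; split.
  apply/and4P; split; last by rewrite cB.
  - by apply/fintype.subsetP => e /hB; rewrite inE => /andP[].
  - by apply/forall_inP => e /hB; rewrite inE => /and5P[].
  - apply: disjointWl (BA) _; apply: disjointWr dA.
    exact: (imsetS (act_pair s) BA).
apply/andP; split; apply/forall_inP => e.
  by move=> /hB; rewrite inE => /and5P[].
move=> /imsetP[f /hB + ->]; rewrite inE => /and5P[_ _ _ _].
by rewrite /act_pair adj_ordpair.
Qed.

(** * Expectations under the correlated block model *)

Lemma graph_of_subproof n (f : {ffun 'I_n * 'I_n -> bool}) :
  is_simple [ffun e : 'I_n * 'I_n => (e.1 != e.2) && f (ordpair e.1 e.2)].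
Proof.
apply/andP; split; first by apply/forallP => i; rewrite ffunE eqxx.
apply/forallP => i; apply/forallP => j; rewrite !ffunE /=.
by rewrite ordpairC (eq_sym i j).
Qed.

(** Only the values of f on increasing pairs are read, so [graph_of] inverts the
    restriction of a graph to its increasing pairs. *)
Definition graph_of n (f : {ffun 'I_n * 'I_n -> bool}) : sgraph n :=
  SGraph (graph_of_subproof f).

(** Simple graphs correspond to the boolean functions on increasing pairs, so
    this is the distributivity of products over sums. *)
Lemma sum_sgraph_prod (R : realType) n (F : 'I_n * 'I_n -> bool -> R) :
  \sum_(G : sgraph n) \prod_(e : 'I_n * 'I_n | (e.1 < e.2)%N)
     F e (adj G e.1 e.2) =
  \prod_(e : 'I_n * 'I_n | (e.1 < e.2)%N) (F e true + F e false).
Proof.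
pose h (G : sgraph n) : {ffun 'I_n * 'I_n -> bool} :=
  [ffun e : 'I_n * 'I_n => (e.1 < e.2)%N && adj G e.1 e.2].
under [RHS]eq_bigr do rewrite -(big_bool _ (F _)).
rewrite (big_distr_big_dep false) (reindex_onto h (@graph_of n)) /=.
  apply: eq_big => [G|G _]; last first.
    by apply: eq_bigr => e lte; rewrite /h ffunE lte.
  symmetry; apply/andP; split.
    apply/pfamilyP; split => //; apply/fintype.subsetP => e.
    by rewrite inE /h ffunE unfold_in; case: (_ < _)%N.
  apply/eqP/val_inj/ffunP => -[i j]; rewrite /= !ffunE /=.
  case: eqVneq => [->|ij] /=; first exact/esym/adj_irr.
  by rewrite ordpair_lt //= adj_ordpair.
move=> f /pfamilyP [fs _]; apply/ffunP => e; rewrite !ffunE /adj /= !ffunE /=.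
case: (boolP (e.1 < e.2)%N) => lte /=.
  rewrite /ordpair lte -surjective_pairing neq_ltn.
  by move: lte; rewrite /= => ->.
apply/esym/negbTE; apply: contraNN lte => fe.
by apply: (fintype.subsetP fs); rewrite inE fe.
Qed.

(** The mass of (G, G_1, G_2') once the independent permutation is removed. *)
Definition csbm_weight (R : realType) n (th : csbm_params R n)
    (G G1 G2 : sgraph n) : R :=
  indep_edges_pmf (edge_prob th) G
  * indep_edges_pmf (thin_prob (sprob th) G) G1
  * indep_edges_pmf (thin_prob (sprob th) G) G2.

Definition csbm_expect (R : realType) n (th : csbm_params R n)
    (X : sgraph n -> sgraph n -> R) : R :=
  \sum_(G : sgraph n) \sum_(G1 : sgraph n) \sum_(G2 : sgraph n)
    csbm_weight th G G1 G2 * X G1 G2.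

(** The mean of x (e in G_1) (e in G_2') for a single edge e that the parent
    graph has with probability p. *)
Definition edge_expect (R : realType) (p s : R) (x : bool -> bool -> R) : R :=
  p * (s * (s * x true true + (1 - s) * x true false)
       + (1 - s) * (s * x false true + (1 - s) * x false false))
  + (1 - p) * x false false.

(** The triples (G e, G_1 e, G_2' e) are independent over the edges e; this is
    used for every probability computed below. *)
Lemma csbm_expect_prod (R : realType) n (th : csbm_params R n)
    (x : 'I_n * 'I_n -> bool -> bool -> R) :
  csbm_expect th (fun G1 G2 => \prod_(e : 'I_n * 'I_n | (e.1 < e.2)%N)
     x e (adj G1 e.1 e.2) (adj G2 e.1 e.2)) =
  \prod_(e : 'I_n * 'I_n | (e.1 < e.2)%N)
     edge_expect (edge_prob th e.1 e.2) (sprob th) (x e).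
Proof.
rewrite /csbm_expect; set s := sprob th.
pose tp (b : bool) : R := if b then s else 0.
pose F2 e b b1 b2 := bernoulli_pmf (edge_prob th e.1 e.2) b
  * bernoulli_pmf (tp b) b1 * bernoulli_pmf (tp b) b2 * x e b1 b2.
pose F1 e b b1 := F2 e b b1 true + F2 e b b1 false.
pose F0 e b := F1 e b true + F1 e b false.
transitivity (\sum_(G : sgraph n) \prod_(e : 'I_n * 'I_n | (e.1 < e.2)%N)
     F0 e (adj G e.1 e.2)).
  apply: eq_bigr => G _.
  rewrite -[RHS](sum_sgraph_prod (fun e => F1 e (adj G e.1 e.2))).
  apply: eq_bigr => G1 _.
  rewrite -[RHS](sum_sgraph_prod
    (fun e => F2 e (adj G e.1 e.2) (adj G1 e.1 e.2))).
  by apply: eq_bigr => G2 _; rewrite /csbm_weight /indep_edges_pmf -!big_split.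
rewrite sum_sgraph_prod; apply: eq_bigr => e _.
by rewrite /F0 /F1 /F2 /tp /bernoulli_pmf /edge_expect -/s; ring.
Qed.

Lemma in_commE (R : realType) n (th : csbm_params R n) i a b :
  i \in comm th a -> (i \in comm th b) = (b == a).
Proof.
move=> ia; apply/idP/eqP => [ib|-> //]; apply/eqP/negPn/negP.
by move=> /comm_disjoint /disjointFr /(_ ib); rewrite ia.
Qed.

Lemma edge_probE (R : realType) n (th : csbm_params R n) i j a b :
  i \in comm th a -> j \in comm th b -> edge_prob th i j = qprob th a b.
Proof.
move=> ia jb; rewrite /edge_prob (big_pred1 a) => [|c]; last exact: in_commE.
by rewrite (big_pred1 b) => [|c]; last exact: in_commE.
Qed.

Lemma comm_ex (R : realType) n (th : csbm_params R n) i :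
  exists a, i \in comm th a.
Proof.
have : i \in \bigcup_a comm th a by rewrite comm_cover inE.
by case/bigcupP => a _; exists a.
Qed.

Lemma edge_prob01 (R : realType) n (th : csbm_params R n) i j :
  0 <= edge_prob th i j <= 1.
Proof.
have [a ia] := comm_ex th i; have [b jb] := comm_ex th j.
by rewrite (edge_probE ia jb) qprob01.
Qed.

Lemma edge_probC (R : realType) n (th : csbm_params R n) i j :
  edge_prob th i j = edge_prob th j i.
Proof.
have [a ia] := comm_ex th i; have [b jb] := comm_ex th j.
by rewrite (edge_probE ia jb) (edge_probE jb ia) qprob_sym.
Qed.

Lemma sum_edge_prob (R : realType) n (th : csbm_params R n) i a :
  i \in comm th a ->
  \sum_j edge_prob th i j = \sum_b #|comm th b|%:R * qprob th a b.
Proof.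
move=> ia; rewrite /edge_prob.
transitivity (\sum_j \sum_(b | j \in comm th b) qprob th a b).
  apply: eq_bigr => j _; have [b jb] := comm_ex th j.
  rewrite -/(edge_prob th i j) (edge_probE ia jb).
  rewrite (big_pred1 b) // => c.
  exact: in_commE.
rewrite (exchange_big_dep predT) //=; apply: eq_bigr => b _.
by rewrite sumr_const mulr_natl.
Qed.

Lemma thin_prob01 (R : realType) n (th : csbm_params R n) (G : sgraph n) i j :
  0 <= thin_prob (sprob th) G i j <= 1.
Proof. by rewrite /thin_prob; case: ifP; rewrite ?sprob01 // lexx ler01. Qed.

Lemma csbm_weight_ge0 (R : realType) n (th : csbm_params R n)
    (G G1 G2 : sgraph n) : 0 <= csbm_weight th G G1 G2.
Proof.
rewrite /csbm_weight /indep_edges_pmf !mulr_ge0 // prodr_ge0 // => e _;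
  by rewrite bernoulli_pmf_ge0 // (edge_prob01, thin_prob01).
Qed.

Lemma csbm_expect1 (R : realType) n (th : csbm_params R n) :
  csbm_expect th (fun _ _ => 1) = 1.
Proof.
transitivity (csbm_expect th (fun G1 G2 =>
   \prod_(e : 'I_n * 'I_n | (e.1 < e.2)%N) (1 : R))).
  by do 3!apply: eq_bigr => ? _; rewrite big1.
rewrite (csbm_expect_prod th (fun _ _ _ => 1)) big1 // => e _.
by rewrite /edge_expect; ring.
Qed.

Lemma ler_csbm_expect (R : realType) n (th : csbm_params R n) X Y :
  (forall G1 G2, X G1 G2 <= Y G1 G2) -> csbm_expect th X <= csbm_expect th Y.
Proof.
move=> XY; do 3!apply: ler_sum => ? _.
by rewrite ler_wpM2l // csbm_weight_ge0.
Qed.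

Lemma csbm_expect_sum (R : realType) n (th : csbm_params R n) (I : finType)
    (P : pred I) X :
  csbm_expect th (fun G1 G2 => \sum_(i | P i) X i G1 G2) =
  \sum_(i | P i) csbm_expect th (X i).
Proof.
rewrite [RHS]exchange_big; apply: eq_bigr => G _.
rewrite [RHS]exchange_big; apply: eq_bigr => G1 _.
rewrite [RHS]exchange_big; apply: eq_bigr => G2 _.
by rewrite mulr_sumr.
Qed.

Lemma csbm_expectD (R : realType) n (th : csbm_params R n) X Y :
  csbm_expect th (fun G1 G2 => X G1 G2 + Y G1 G2) =
  csbm_expect th X + csbm_expect th Y.
Proof.
rewrite -big_split; apply: eq_bigr => G _.
rewrite -big_split; apply: eq_bigr => G1 _.
rewrite -big_split; apply: eq_bigr => G2 _.
by rewrite mulrDr.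
Qed.

Lemma csbm_expectZ (R : realType) n (th : csbm_params R n) c X :
  csbm_expect th (fun G1 G2 => c * X G1 G2) = c * csbm_expect th X.
Proof.
rewrite mulr_sumr; apply: eq_bigr => G _.
rewrite mulr_sumr; apply: eq_bigr => G1 _.
rewrite mulr_sumr; apply: eq_bigr => G2 _.
by rewrite mulrCA.
Qed.

(** The permutation is uniform and independent of the graphs. *)
Lemma csbm_probE (R : realType) n (th : csbm_params R n)
    (A : sgraph n -> sgraph n -> {perm 'I_n} -> bool) :
  csbm_prob th A = (n`!%:R)^-1 *
    \sum_(pi : {perm 'I_n})
      csbm_expect th (fun G1 G2 => (A G1 (relabel pi G2) pi)%:R).
Proof.
rewrite mulr_sumr /csbm_prob; under [RHS]eq_bigr do rewrite mulr_sumr.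
rewrite [RHS]exchange_big; apply: eq_bigr => G _.
under [RHS]eq_bigr do rewrite mulr_sumr.
rewrite [RHS]exchange_big; apply: eq_bigr => G1 _.
under [RHS]eq_bigr do rewrite mulr_sumr.
rewrite [RHS]exchange_big; apply: eq_bigr => G2 _.
rewrite big_mkcond; apply: eq_bigr => pi _.
by case: (A _ _ _); rewrite /csbm_pmf /csbm_weight /= ?mulr1 ?mulr0 // mulrC.
Qed.

(** * First-moment bounds *)

Lemma bin_leq_exp2 m k : ('C(m, k) <= 2 ^ m)%N.
Proof.
elim: m k => [|m IHm] [|k]; rewrite ?bin0n ?bin0 ?expn_gt0 //.
by rewrite binS expnS mul2n -addnn leq_add.
Qed.

Lemma leq_ffact_exp m t : (m ^_ t <= m ^ t)%N.
Proof.
rewrite ffact_prod -[t in (m ^ t)%N]card_ord -prod_nat_const.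
by apply: leq_prod => i _; rewrite leq_subr.
Qed.

Lemma leq_exp_ffact d t : (d ^ t <= (d + t) ^_ t)%N.
Proof.
rewrite ffact_prod -[t in (d ^ t)%N]card_ord -prod_nat_const.
by apply: leq_prod => i _; have := ltn_ord i; lia.
Qed.

(** The binomial is at most (2 n d) ^ t / t!, and for t >= d the factor
    d ^ t / t! is at most binomial (d + t) t <= 4 ^ t. *)
Lemma bin_mul_leq_exp n d t : (d <= t)%N -> ('C(2 * n * d, t) <= (8 * n) ^ t)%N.
Proof.
move=> dt; rewrite -(leq_pmul2r (fact_gt0 t)) bin_ffact.
apply: leq_trans (leq_ffact_exp _ _) _.
rewrite expnMn (_ : 8 * n = 2 * n * 2 ^ 2)%N; last by lia.
rewrite (expnMn (2 * n)) -mulnA leq_mul2l; apply/orP; right.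
apply: leq_trans (leq_exp_ffact d t) _; rewrite -bin_ffact leq_mul2r.
apply/orP; right; apply: leq_trans (bin_leq_exp2 _ _) _.
by rewrite -expnM leq_exp2l //; lia.
Qed.

Lemma card_witness n (s : {perm 'I_n}) t : (#|moved s| <= t)%N ->
  (#|[pred T | witness s t T]| <= (8 * n) ^ t)%N.
Proof.
move=> dt; apply: leq_trans (bin_mul_leq_exp n dt).
apply: (@leq_trans 'C(#|touching s|, t)).
  rewrite -cards_draws; apply: subset_leq_card; apply/fintype.subsetP => T.
  by rewrite !inE => /and4P[-> _ _ ->].
apply: leq_bin2l; apply: leq_trans (leq_card_setU _ _).1 _.
by rewrite !cardsX cardsT card_ord (mulnC _ n) -mulnDl addnn mul2n.
Qed.

(** An edge of G_1 or of G_2' is an edge of the parent graph, which happens with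
    probability at most q, independently for the 2 t distinct edges of T and
    of its image. *)
Lemma expect_present (R : realType) n (th : csbm_params R n) (q : R)
    (s : {perm 'I_n}) t T :
  (forall i j, edge_prob th i j <= q) -> witness s t T ->
  csbm_expect th (fun G1 G2 => (present G1 G2 s T)%:R) <= q ^+ (2 * t).
Proof.
move=> pq /and4P[_ /forall_inP Tlt dT /eqP cT].
have s01 := sprob01 th.
pose U := T :|: act_pair s @: T.
have Ult e : e \in U -> (e.1 < e.2)%N.
  rewrite inE => /orP[/Tlt //|/imsetP[f /Tlt flt ->]].
  by rewrite ordpair_lt // (inj_eq perm_inj) neq_ltn flt.
pose x (e : 'I_n * 'I_n) (b1 b2 : bool) : R :=
  (((e \in T) ==> b1) && ((e \in act_pair s @: T) ==> b2))%:R.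
apply: (@le_trans _ _ (csbm_expect th (fun G1 G2 =>
   \prod_(e : 'I_n * 'I_n | (e.1 < e.2)%N)
     x e (adj G1 e.1 e.2) (adj G2 e.1 e.2)))).
  apply: ler_csbm_expect => G1 G2; case: (boolP (present _ _ _ _)) => pr.
    move: pr => /andP[/forall_inP p1 /forall_inP p2].
    rewrite big1 // => e _; rewrite /x.
    by rewrite (introT implyP (p1 e)) (introT implyP (p2 e)).
  by apply: prodr_ge0 => e _; rewrite /x ler0n.
rewrite csbm_expect_prod.
have -> : q ^+ (2 * t) = \prod_(e : 'I_n * 'I_n | (e.1 < e.2)%N)
    (if e \in U then q else 1).
  rewrite -big_mkcondr /=.
  rewrite (eq_bigl (mem U)) => [|e]; last first.
    by apply/andP/idP => [[]//|eU]; split => //; apply: Ult.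
  rewrite GRing.prodr_const /U cardsU (disjoint_setI0 dT) cards0 subn0.
  rewrite card_in_imset ?cT ?mul2n ?addnn // => e f eT fT.
  by apply: act_pair_inj; rewrite inE Tlt.
apply: ler_prod => e _.
have p01 := edge_prob01 th e.1 e.2; have pqe := pq e.1 e.2.
rewrite /edge_expect /x /U inE; move: (edge_prob _ _ _) p01 pqe => p p01 pqe.
move: (sprob th) s01 => r r01.
have /andP[ps0 ps1] : 0 <= p * r <= p by apply/andP; split; nra.
have /andP[pss0 pss1] : 0 <= p * r * r <= p * r by apply/andP; split; nra.
by case: (e \in T); case: (e \in act_pair s @: T) => /=; apply/andP; split; nra.
Qed.

Lemma expect_kcore_perm (R : realType) n (th : csbm_params R n) (q : R) k
    (s : {perm 'I_n}) t :
  0 <= q -> (forall i j, edge_prob th i j <= q) ->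
  (#|moved s| <= t)%N ->
  (forall m, k.-1 * #|moved s| <= 6 * m -> t <= m)%N ->
  csbm_expect th (fun G1 G2 => (kcore_perm k G1 G2 s)%:R)
    <= (8 * n%:R * q ^+ 2) ^+ t.
Proof.
move=> q0 pq dt tmin.
apply: (@le_trans _ _ (csbm_expect th (fun G1 G2 =>
   \sum_(T | witness s t T) (present G1 G2 s T)%:R))).
  apply: ler_csbm_expect => G1 G2; case: (boolP (kcore_perm _ _ _ _)) => kc.
    have [T /andP[wT pT]] := kcore_perm_witness kc tmin.
    by rewrite (bigD1 T) //= pT lerDl sumr_ge0 // => ? _; rewrite ler0n.
  by apply: sumr_ge0 => ? _; rewrite ler0n.
rewrite csbm_expect_sum.
apply: (@le_trans _ _ (\sum_(T | witness s t T) q ^+ (2 * t))).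
  by apply: ler_sum => T wT; apply: expect_present.
rewrite GRing.sumr_const -[leLHS]mulr_natl exprMn exprM.
rewrite ler_wpM2r ?exprn_ge0 // -(natrM _ 8) -natrX ler_nat.
exact: card_witness.
Qed.

Lemma moved_gt1 n (s : {perm 'I_n}) : s != 1%g -> (1 < #|moved s|)%N.
Proof.
move=> s1; have [i si] : exists i, s i != i.
  apply/existsP; apply: contraNT s1 => /existsPn h.
  by apply/eqP/permP => i; rewrite perm1; apply/eqP; have := h i; rewrite negbK.
apply/card_gt1P; exists (s i), i; rewrite !inE (inj_eq perm_inj).
by split.
Qed.

(** The permutations whose set of moved points is D are among the d! that fix
    the complement of D, where d = #|D|, and binomial n d * d! <= n ^ d.  A
    nonidentity permutation moves at least two points, which provides the
    square. *)
Lemma sum_moved (R : realType) n (y : R) : 0 <= y -> n%:R * y <= 1 ->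
  \sum_(s : {perm 'I_n} | s != 1%g) y ^+ #|moved s|
    <= n.+1%:R * (n%:R * y) ^+ 2.
Proof.
move=> y0 ny1.
apply: (@le_trans _ _ (\sum_(D : {set 'I_n} | (1 < #|D|)%N)
    \sum_(s in perm_on D) y ^+ #|D|)).
  rewrite (partition_big (@moved n) (fun D => (1 < #|D|)%N)) /=; last first.
    by move=> s /moved_gt1.
  apply: ler_sum => D _.
  rewrite big_mkcond [leRHS]big_mkcond; apply: ler_sum => s _.
  case: ifP => [/andP[_ /eqP <-]|_]; last first.
    by case: ifP => // _; rewrite exprn_ge0.
  rewrite ifT //; apply/fintype.subsetP => i; by rewrite !inE.
have cD (D : {set 'I_n}) : (#|D| < n.+1)%N.
  by rewrite ltnS -[leqRHS](card_ord n) max_card.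
have nY : 0 <= n%:R * y by rewrite mulr_ge0.
apply: (@le_trans _ _ (\sum_(d < n.+1 | (1 < d)%N) (n%:R * y) ^+ d)).
  rewrite (partition_big (fun D : {set 'I_n} => inord #|D| : 'I_n.+1)
    (fun d => 1 < d)%N) /=; last first.
    by move=> D; rewrite inordK.
  apply: ler_sum => d d1.
  apply: (@le_trans _ _ (\sum_(D : {set 'I_n} | #|D| == d) (d`!%:R * y ^+ d))).
    rewrite big_mkcond [leRHS]big_mkcond; apply: ler_sum => D _.
    have -> : (inord #|D| == d) = (#|D| == d).
      by rewrite -val_eqE /= inordK.
    case: eqP => [Dd|_]; rewrite ?andbF // Dd d1 /=.
    by rewrite GRing.sumr_const card_perm Dd -[leLHS]mulr_natl.
  rewrite GRing.sumr_const -[leLHS]mulr_natl mulrA exprMn.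
  rewrite ler_wpM2r ?exprn_ge0 //.
  rewrite -natrM -natrX ler_nat -(cardsE) card_draws card_ord bin_ffact.
  exact: leq_ffact_exp.
(* Only d >= 2 occurs and n y <= 1, so every term is at most the second. *)
apply: (@le_trans _ _ (\sum_(d < n.+1) (n%:R * y) ^+ 2)).
  rewrite big_mkcond; apply: ler_sum => d _.
  by case: ifP => [d1|_]; rewrite ?exprn_ge0 // ler_wiXn2l.
by rewrite GRing.sumr_const card_ord -[leLHS]mulr_natl.
Qed.

Lemma prod_incident (R : realType) n (i : 'I_n) (F : 'I_n * 'I_n -> R) :
  \prod_(e : 'I_n * 'I_n | (e.1 < e.2)%N && ((e.1 == i) || (e.2 == i))) F e =
  \prod_(j | j != i) F (ordpair i j).
Proof.
rewrite (reindex_onto (ordpair i) (fun e => if e.1 == i then e.2 else e.1)) /=.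
  apply: eq_bigl => j; case: (eqVneq j i) => [->|ji] /=.
    by rewrite /ordpair ltnn /= ltnn.
  rewrite ordpair_lt 1?eq_sym //= /ordpair.
  by case: ifP => _ /=; rewrite ?(eq_sym i j) ?(negbTE ji) ?eqxx ?orbT /= ?eqxx.
move=> [a b] /= /andP[ab]; rewrite /ordpair.
case: (eqVneq a i) => [<- _|ai /= /eqP <-]; first by rewrite ab.
by rewrite ltnNge (ltnW ab).
Qed.

(** Markov's inequality for z ^ degree.  Each edge {i, j} contributes the factor
    1 - (1 - z) s ^ 2 p_ij <= exp (- (1 - z) s ^ 2 p_ij).  The sum over j
    includes j = i, a term at most 1 that the leading 1 in the exponent
    compensates. *)
Lemma expect_low_degree (R : realType) n (th : csbm_params R n) k (z : R)
    (i : 'I_n) :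
  0 < z <= 1 ->
  csbm_expect th (fun G1 G2 => (#|common_nbrs G1 G2 1%g i| < k)%N%:R) <=
  z ^- k * expR (1 - (1 - z) * (sprob th ^+ 2 * \sum_j edge_prob th i j)).
Proof.
move=> /andP[z0 z1]; have s01 := sprob01 th.
pose inc (e : 'I_n * 'I_n) := (e.1 == i) || (e.2 == i).
pose x (e : 'I_n * 'I_n) (b1 b2 : bool) : R :=
  if [&& inc e, b1 & b2] then z else 1.
apply: (@le_trans _ _ (csbm_expect th (fun G1 G2 => z ^- k *
   \prod_(e : 'I_n * 'I_n | (e.1 < e.2)%N)
     x e (adj G1 e.1 e.2) (adj G2 e.1 e.2)))).
  apply: ler_csbm_expect => G1 G2.
  have -> : \prod_(e : 'I_n * 'I_n | (e.1 < e.2)%N)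
     x e (adj G1 e.1 e.2) (adj G2 e.1 e.2) = z ^+ #|common_nbrs G1 G2 1%g i|.
    transitivity (\prod_(e : 'I_n * 'I_n | (e.1 < e.2)%N && inc e)
        if adj G1 e.1 e.2 && adj G2 e.1 e.2 then z else 1).
      rewrite big_mkcondr /=; apply: eq_bigr => e _.
      by rewrite /x; case: (inc e).
    rewrite prod_incident -big_mkcondr /= -GRing.prodr_const.
    apply: eq_bigl => j; rewrite !inE !perm1 !adj_ordpair.
    by case: eqVneq => // ->; rewrite adj_irr.
  have z0' := ltW z0; case: ltnP => lk.
    by rewrite mulrC ler_pdivlMr ?exprn_gt0 // mul1r ler_wiXn2l // ltnW.
  by rewrite mulr_ge0 ?invr_ge0 ?exprn_ge0.
rewrite csbm_expectZ ler_wpM2l ?invr_ge0 ?exprn_ge0 ?(ltW z0) //.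
rewrite csbm_expect_prod.
pose c := (1 - z) * sprob th ^+ 2.
have c01 : 0 <= c <= 1 by rewrite /c; apply/andP; split; nra.
have -> : \prod_(e : 'I_n * 'I_n | (e.1 < e.2)%N)
    edge_expect (edge_prob th e.1 e.2) (sprob th) (x e) =
  \prod_(j | j != i) (1 - c * edge_prob th i j).
  transitivity (\prod_(e : 'I_n * 'I_n | (e.1 < e.2)%N && inc e)
     (1 - c * edge_prob th e.1 e.2)).
    rewrite big_mkcondr /=; apply: eq_bigr => e _.
    by rewrite /edge_expect /x; case: (inc e) => /=; rewrite /c; ring.
  rewrite prod_incident; apply: eq_bigr => j _; rewrite /ordpair.
  by case: ifP => // _; rewrite edge_probC.
apply: (@le_trans _ _ (\prod_(j | j != i) expR (- (c * edge_prob th i j)))).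
  apply: ler_prod => j _; have := edge_prob01 th i j => p01.
  by rewrite expR_ge1Dx andbT; nra.
rewrite -expR_sum ler_expR [in leRHS](bigD1 i) //= sumrN -mulr_sumr.
have := edge_prob01 th i i; rewrite mulrA -/c.
by move: (\sum_(_ | _) _) => S p01; nra.
Qed.

(** * From the two good properties to recovery *)

(** The truth has full size, so the estimator has full size too and is given by
    a permutation; the second hypothesis leaves only the truth. *)
Lemma recovers_of_good n k (G1 G2 : sgraph n) (pi : {perm 'I_n}) Mmu :
  (forall i, k <= #|common_nbrs G1 G2 1%g i|)%N ->
  (forall s : {perm 'I_n}, s != 1%g -> ~~ kcore_perm k G1 G2 s) ->
  is_max_kcore_matching k G1 (relabel pi G2) Mmu.1 Mmu.2 ->
  recovers pi Mmu.
Proof.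
case: Mmu => M mu /= good1 bad [[inj core] maxM].
have pi_core : is_kcore_matching k G1 (relabel pi G2) [set: 'I_n] pi.
  split; first by move=> i j _ _; apply: perm_inj.
  move=> i _; apply: leq_trans (good1 i) _.
  apply/subset_leq_card/fintype.subsetP => j.
  by rewrite !inE !perm1 adj_relabel.
have MT : M = [set: 'I_n].
  by apply/eqP; rewrite finset.eqEcard finset.subsetT; apply: maxM pi_core.
rewrite /recovers /= MT eqxx /=; apply/forallP => i.
have mu_inj : injective mu.
  by move=> a b ab; apply: inj ab; rewrite MT inE.
pose s : {perm 'I_n} := (perm mu_inj * pi^-1)%g.
have muE j : mu j = pi (s j) by rewrite permM permKV permE.
have : ~~ (s != 1%g).
  apply/negP => /bad /negP; apply; apply/forallP => j.
  apply: leq_trans (core j _) _; first by rewrite MT inE.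
  apply/subset_leq_card/fintype.subsetP => l.
  by rewrite !inE !muE adj_relabel => /andP[].
by rewrite negbK muE => /eqP ->; rewrite perm1.
Qed.

(** The complementary event is bounded through any random variable X that
    dominates its indicator, uniformly in the permutation. *)
Lemma csbm_prob_ge (R : realType) n (th : csbm_params R n)
    (A : sgraph n -> sgraph n -> {perm 'I_n} -> bool)
    (X : sgraph n -> sgraph n -> R) :
  (forall G1 G2 pi, 1 - X G1 G2 <= (A G1 (relabel pi G2) pi)%:R) ->
  1 - csbm_expect th X <= csbm_prob th A.
Proof.
move=> XA; rewrite csbm_probE.
have f0 : (0 : R) < n`!%:R by rewrite ltr0n fact_gt0.
rewrite mulrC ler_pdivlMr // mulr_natr -[in n`!]card_Sn -GRing.sumr_const.
apply: ler_sum => pi _.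
rewrite -{1}(csbm_expect1 th) -mulN1r -csbm_expectZ -csbm_expectD.
by apply: ler_csbm_expect => G1 G2; rewrite mulN1r.
Qed.

Lemma csbm_prob_le1 (R : realType) n (th : csbm_params R n) A :
  csbm_prob th A <= 1.
Proof.
rewrite csbm_probE; have f0 : (0 : R) < n`!%:R by rewrite ltr0n fact_gt0.
rewrite mulrC ler_pdivrMr // mul1r -[in n`!]card_Sn -GRing.sumr_const.
apply: ler_sum => pi _; rewrite -[leRHS](csbm_expect1 th).
by apply: ler_csbm_expect => G1 G2; rewrite lern1 leq_b1.
Qed.

(** The failure probability is at most the expected number of vertices of low
    degree plus the expected number of wrong k-core permutations.  Since
    b <= 1, raising b to t = ceil ((k - 1) d / 6) gives at most y ^ d; the
    condition 7 <= k ensures t >= d. *)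
Lemma recovery_prob_ge (R : realType) n (th : csbm_params R n) k (q z ell : R)
    (est : sgraph n -> sgraph n -> {set 'I_n} * ('I_n -> 'I_n)) :
  (7 <= k)%N -> 0 < z <= 1 -> 0 < q ->
  (forall i j, edge_prob th i j <= q) ->
  (forall i, ell <= sprob th ^+ 2 * \sum_j edge_prob th i j) ->
  let b := 8 * n%:R * q ^+ 2 in
  let y := b `^ (k.-1%:R / 6) in
  (0 < n)%N -> b <= 1 -> n%:R * y <= 1 ->
  is_kcore_estimator k est ->
  1 - (n%:R * (z ^- k * expR (1 - (1 - z) * ell))
       + n.+1%:R * (n%:R * y) ^+ 2) <=
  csbm_prob th (fun G1 G2 pi => recovers pi (est G1 G2)).
Proof.
move=> k7 z01 q0 pq hell b y n0 b1 ny1 est_max.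
have b0 : 0 < b by rewrite /b !mulr_gt0 ?exprn_gt0 // ltr0n.
pose X (G1 G2 : sgraph n) : R :=
  \sum_i (#|common_nbrs G1 G2 1%g i| < k)%N%:R
  + \sum_(s : {perm 'I_n} | s != 1%g) (kcore_perm k G1 G2 s)%:R.
apply: (@le_trans _ _ (1 - csbm_expect th X)); last first.
  apply: csbm_prob_ge => G1 G2 pi.
  have S0 : 0 <= \sum_(s : {perm 'I_n} | s != 1%g)
      (kcore_perm k G1 G2 s)%:R :> R.
    by apply: sumr_ge0 => ? _; rewrite ler0n.
  have D0 : 0 <= \sum_i (#|common_nbrs G1 G2 1%g i| < k)%N%:R :> R.
    by apply: sumr_ge0 => ? _; rewrite ler0n.
  have [h1|/existsPn h1] := boolP [exists i, #|common_nbrs G1 G2 1%g i| < k]%N.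
    have [i hi] := existsP h1.
    apply: (@le_trans _ _ 0); last by rewrite ler0n.
    rewrite subr_le0 /X (bigD1 i) //= hi -addrA lerDl addr_ge0 //.
    by apply: sumr_ge0 => ? _; rewrite ler0n.
  have [h2|h2] := boolP [exists s : {perm 'I_n},
      (s != 1%g) && kcore_perm k G1 G2 s].
    have [s /andP[s1 hs]] := existsP h2.
    apply: (@le_trans _ _ 0); last by rewrite ler0n.
    rewrite subr_le0 /X [X in _ <= _ + X](bigD1 s) //= hs addrCA lerDl.
    rewrite addr_ge0 //.
    by apply: sumr_ge0 => ? _; rewrite ler0n.
  rewrite (@recovers_of_good _ k G1 G2); first by rewrite gerBl addr_ge0.
  - by move=> i; have := h1 i; rewrite -leqNgt.
  - move=> s s1; move/existsPn: h2 => /(_ s); by rewrite s1.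
  - exact: est_max.
rewrite lerD2l lerN2 /X csbm_expectD !csbm_expect_sum lerD //.
  rewrite mulr_natl -[X in _ *+ X](card_ord n) -GRing.sumr_const.
  apply: ler_sum => i _; apply: le_trans (expect_low_degree th k i z01) _.
  rewrite ler_wpM2l ?invr_ge0 ?exprn_ge0 //; first by case/andP: z01 => /ltW.
  rewrite ler_expR lerD2l lerN2 ler_wpM2l //.
  by case/andP: z01 => _; rewrite subr_ge0.
apply: le_trans (sum_moved (powR_ge0 _ _) ny1); apply: ler_sum => s _.
pose t := ((k.-1 * #|moved s| + 5) %/ 6)%N.
have td : (k.-1 * #|moved s| <= 6 * t)%N by rewrite /t; lia.
apply: le_trans (@expect_kcore_perm _ _ th q k s t (ltW q0) pq _ _) _.
- have : (6 * #|moved s| <= k.-1 * #|moved s|)%N by rewrite leq_mul2r; lia.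
  by lia.
- by move=> m; rewrite /t; lia.
rewrite -/b -powR_mulrn ?(ltW b0) // -powR_mulrn ?powR_ge0 // -powRrM.
apply: ger_powR; first by rewrite b0.
rewrite mulrAC ler_pdivrMr // -natrM mulrC -(natrM _ 6) ler_nat.
exact: td.
Qed.

(** * Asymptotics *)

Local Open Scope classical_set_scope.
Local Open Scope ring_scope.

Lemma near_ln_ge (R : realType) (A : R) :
  \forall n \near \oo, A <= ln (n%:R : R).
Proof.
near=> n.
have An : expR A <= n%:R by near: n; apply: nbhs_infty_ger.
have n0 : 0 < n%:R :> R by apply: lt_le_trans (expR_gt0 A) An.
by rewrite -[A]expRK ler_ln // posrE ?expR_gt0.
Unshelve. all: by end_near.
Qed.

Lemma cvg_expR_ln (R : realType) (c : R) : 0 < c ->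
  expR (- (c * ln (n%:R : R))) @[n --> \oo] --> 0.
Proof.
move=> c0.
have h : c * ln (n%:R : R) @[n --> \oo] --> +oo.
  apply/cvgryPge => A; near=> n; rewrite mulrC -ler_pdivrMr //.
  by near: n; apply: near_ln_ge.
exact: (cvg_comp _ _ h (@cvgr_expR R)).
Unshelve. all: by end_near.
Qed.

(** With L = log n, the logarithm of n ^ 3 y ^ 2 is, up to a constant,
    (3 - 2 kappa (2 alpha - 1) + 4 kappa e) L, and the bounds on kappa and e
    make the factor of L at most 3 - 11 / 3 + 1 / 3 = - 1 / 3.  The lower bound
    on L absorbs the constants in the first two conclusions. *)
Lemma wrong_perm_rate (R : realType) n (alpha e kappa : R) :
  let L := ln (n%:R : R) in
  let b := 8 * n%:R * (n%:R `^ (- alpha + e)) ^+ 2 in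
  let y := b `^ kappa in
  (0 < n)%N -> 0 < kappa -> 11 / 3 <= 2 * kappa * (2 * alpha - 1) ->
  `|e| <= (12 * kappa)^-1 -> 2 * kappa * ln 8 <= L ->
  [/\ b <= 1, n%:R * y <= 1 &
      n.+1%:R * (n%:R * y) ^+ 2 <=
        2 * expR (2 * kappa * ln 8) * expR (- (3^-1 * L))].
Proof.
move=> L b y n0 k0 ka he hL.
have nR0 : 0 < n%:R :> R by rewrite ltr0n.
have nE : n%:R = expR L by rewrite lnK.
pose E := ln 8 + L * (1 - 2 * alpha + 2 * e).
have bE : b = expR E.
  rewrite /b /E /powR gt_eqF // -/L {1}nE -[8 in LHS]lnK ?posrE //.
  by rewrite -expRM_natl -!expRD; congr expR; ring.
have yE : y = expR (kappa * E) by rewrite /y bE mulrC expRM.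
have ln8 : 0 <= ln 8 :> R by rewrite ln_ge0 // ler1n.
have L0 : 0 <= L by apply: le_trans hL; rewrite !mulr_ge0 // ltW.
have ke : kappa * e <= 12^-1.
  have : kappa * `|e| <= 12^-1.
    rewrite -(ler_pM2l k0) in he; apply: le_trans he _.
    by rewrite invfM mulrCA mulfV ?gt_eqF // mulr1.
  by apply: le_trans; rewrite ler_pM2l // ler_norm.
have kE : kappa * E <= kappa * ln 8 - 5 / 3 * L.
  rewrite /E mulrDr lerD2l.
  rewrite (_ : _ * (_ * _) =
    L * (2 * (kappa * e) - kappa * (2 * alpha - 1))); last by ring.
  by rewrite -[leRHS]mulNr [leRHS]mulrC ler_wpM2l //; lra.
have E0 : E <= 0 by rewrite -(pmulr_rle0 _ k0); nra.
have nyE : n%:R * y = expR (L + kappa * E) by rewrite yE {1}nE expRD.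
split.
- by rewrite bE -expR0 ler_expR.
- by rewrite nyE -expR0 ler_expR; nra.
apply: (@le_trans _ _ (2 * n%:R * (n%:R * y) ^+ 2)).
  rewrite ler_wpM2r ?exprn_ge0 ?nyE ?expR_ge0 //.
  by rewrite -(natrM _ 2) ler_nat mul2n -addnn -addn1 leq_add2l.
rewrite nyE -expRM_natl {1}nE -!mulrA ler_pM2l // -!expRD ler_expR; nra.
Qed.

Theorem corollary1 (R : realType) (th : forall n : nat, csbm_params R n)
    (alpha : R) (k : nat) (eps : R)
    (est : forall n : nat, sgraph n -> sgraph n ->
             {set 'I_n} * ('I_n -> 'I_n)) :
  1 / 2 < alpha <= 1 ->
  (exists2 e : nat -> R, e n @[n --> \oo] --> (0 : R) &
     forall n : nat, (0 < n)%N ->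
       forall a b : 'I_(ncomm (th n)),
         qprob (th n) a b <= n%:R `^ (- alpha + e n)) ->
  (0 < k)%N ->
  12 / (2 * alpha - 1) < k%:R ->
  0 < eps ->
  (forall n : nat, (0 < n)%N ->
     forall a : 'I_(ncomm (th n)),
       (1 + eps) * ln n%:R <=
       \sum_(b < ncomm (th n))
          #|comm (th n) b|%:R * qprob (th n) a b * sprob (th n) ^+ 2) ->
  (forall n : nat, is_kcore_estimator k (est n)) ->
  csbm_prob (th n) (fun G1 G2 pi => recovers pi (est n G1 G2)) @[n --> \oo]
    --> (1 : R).
Proof.
move=> /andP[a12 a1] [e e0 hq] k0 hk eps0 hdeg hest.
have a0 : 0 < 2 * alpha - 1 by lra.
move: hk; rewrite ltr_pdivrMr // => hk.
have k13 : (12 < k)%N.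
  rewrite -(ltr_nat R); apply: lt_le_trans hk _.
  by rewrite -[leRHS]mulr1 ler_wpM2l //; lra.
have kE : k.-1%:R = k%:R - 1 :> R by rewrite -{2}(prednK k0) mulrSr addrK.
(* (k - 1) (2 alpha - 1) > 12 - (2 alpha - 1) >= 11, as alpha <= 1. *)
pose kappa : R := k.-1%:R / 6.
have kappa0 : 0 < kappa by rewrite divr_gt0 // ltr0n; lia.
have hkappa : 11 / 3 <= 2 * kappa * (2 * alpha - 1).
  by rewrite /kappa kE; lra.
(* This z makes (1 - z) (1 + eps) = 1 + eps / 2 exceed 1. *)
pose z := eps / (2 * (1 + eps)).
have eps1 : 0 < 1 + eps by lra.
have z01 : 0 < z <= 1.
  by rewrite /z divr_gt0 ?mulr_gt0 //= ler_pdivrMr ?mulr_gt0 // mul1r; lra.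
have zE : (1 - z) * (1 + eps) = 1 + eps / 2.
  by rewrite /z; field; rewrite gt_eqF.
pose C1 := z ^- k * expR 1; pose C2 := 2 * expR (2 * kappa * ln 8).
pose err n := C1 * expR (- (eps / 2 * ln (n%:R : R)))
              + C2 * expR (- (3^-1 * ln (n%:R : R))).
apply: (@squeeze_cvgr _ _ _ _ (fun n => 1 - err n) (fun=> 1)); last first.
- exact: cvg_cst.
- rewrite -[X in _ --> X]subr0; apply: cvgB; first exact: cvg_cst.
  rewrite -[X in _ --> X]addr0 -[X in _ --> X + _](mulr0 C1).
  rewrite -[X in _ --> _ + X](mulr0 C2); apply: cvgD.
    by apply: cvgMr; apply: cvg_expR_ln; rewrite divr_gt0.
  by apply: cvgMr; apply: cvg_expR_ln.
near=> n; rewrite csbm_prob_le1 andbT.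
have n0 : (0 < n)%N by near: n; apply: nbhs_infty_gt.
have en : `|e n| <= (12 * kappa)^-1.
  by near: n; apply: cvgr0_norm_le => //; rewrite invr_gt0 mulr_gt0.
have Ln : 2 * kappa * ln 8 <= ln n%:R by near: n; apply: near_ln_ge.
have [b1 ny1 rate] := wrong_perm_rate n0 kappa0 hkappa en Ln.
have nR0 : 0 < n%:R :> R by rewrite ltr0n.
apply: le_trans (@recovery_prob_ge R n (th n) k (n%:R `^ (- alpha + e n)) z
  ((1 + eps) * ln n%:R) (est n) _ z01 _ _ _ n0 b1 ny1 (hest n)).
- rewrite lerD2l lerN2 lerD //.
  rewrite -{1}(@lnK _ n%:R) // mulrCA /C1 -!mulrA ler_wpM2l //.
    by rewrite invr_ge0 exprn_ge0 //; case/andP: z01 => /ltW.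
  by rewrite -!expRD ler_expR [(1 - z) * _]mulrA zE; lra.
- exact: leq_trans k13.
- by rewrite powR_gt0.
- move=> i j; have [a ia] := comm_ex (th n) i; have [b jb] := comm_ex (th n) j.
  by rewrite (edge_probE ia jb); apply: hq.
- move=> i; have [a ia] := comm_ex (th n) i; rewrite (sum_edge_prob ia).
  apply: le_trans (hdeg n n0 a) _; rewrite mulr_sumr; apply: ler_sum => b _.
  by rewrite [leRHS]mulrC.
Unshelve. all: by end_near.
Qed.
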